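(* If the multivalued semiflow $G:\mathbb{R}^+\times H\to P(H)$ on a uniformly convex Banach space $H$ has a bounded absorbing set, satisfies the flattening condition and satisfies condition ($NW$), then there exists a global attractor for $G$.
   Context: $\mathbb{R}^+=[0,\infty)$; $P(H)$ is the family of all nonempty subsets of $H$. A map $G:\mathbb{R}^+\times H\to P(H)$ is a multivalued semiflow ($m$-semiflow) if (1) $G(0,z)=\{z\}$ for all $z\in H$, and (2) $G(t+s,z)\subset G(t,G(s,z))$ for all $z\in H$ and $t,s\ge 0$. For $B\subset H$, $G(t,B)=\bigcup_{x\in B}G(t,x)$. $G$ has a bounded absorbing set if there exists a bounded set $B_0\subset H$ such that for any bounded $B\subset H$ there exists $t_0>0$ with $\bigcup_{t\ge t_0}G(t,B)\subset B_0$. $G$ satisfies the flattening condition if for every bounded $B\subset H$ and $\epsilon>0$ there exist $t_0=t_0(B,\epsilon)$ and a finite dimensional subspace $E$ of $H$ such that for a bounded projector $P:H\to E$ the set $P\big(\bigcup_{t\ge t_0}G(t,B)\big)$ is bounded in $H$ and $(I-P)\big(\bigcup_{t\ge t_0}G(t,B)\big)\subset B(0,\epsilon)$, where $B(0,\epsilon)$ is the closed ball of radius $\epsilon$ centered at $0$. Here a bounded projector onto $E$ is a map $P:H\to E$, not necessarily linear, with $Px=x$ for $x\in E$, mapping bounded sets to bounded sets. $G$ satisfies condition ($NW$) if for every $t\ge0$: whenever $x_n\to x$ in norm in $H$ and $\xi_n\in G(t,x_n)$, there exists a subsequence $\xi_{k_n}$ converging weakly in $H$ to some $\xi\in G(t,x)$.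 For $A,B\subset H$, $\mathrm{dist}_H(A,B)=\sup_{x\in A}\inf_{y\in B}\|x-y\|$. A set $A\subset H$ is a global attractor for $G$ if (1) $A$ is compact in $H$; (2) $A\subset G(t,A)$ for all $t\ge0$; (3) for every bounded $B\subset H$, $\mathrm{dist}_H(G(t,B),A)\to0$ as $t\to\infty$. *)

(* Defs.v *)
From HB Require Import structures.
From mathcomp Require Import all_boot all_order all_algebra.
From mathcomp Require Import all_classical all_reals.
From mathcomp Require Import ereal topology normedtype sequences.

Set Implicit Arguments.
Unset Strict Implicit.
Unset Printing Implicit Defensive.

Import Order.TTheory GRing.Theory Num.Theory.
Import numFieldNormedType.Exports.

Local Open Scope classical_set_scope.
Local Open Scope ring_scope.

(* Clarkson's definition, on the unit sphere. *)
Definition uniformly_convex (R : realType) (H : normedModType R) : Prop :=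
  forall eps : R, 0 < eps <= 2 ->
  exists2 delta : R, 0 < delta &
    forall x y : H, `|x| = 1 -> `|y| = 1 -> eps <= `|x - y| ->
      `|2^-1 *: (x + y)| <= 1 - delta.

Definition weak_cvg (R : realType) (H : normedModType R)
    (u : nat -> H) (l : H) : Prop :=
  forall f : {linear H -> R^o}, continuous f -> f (u n) @[n --> \oo] --> f l.

Definition fin_dim_subspace (R : realType) (H : lmodType R) (E : set H) : Prop :=
  exists (n : nat) (e : 'I_n -> H),
    E = [set \sum_(i < n) c i *: e i | c in [set: 'I_n -> R]].

(* P need be neither linear nor continuous. *)
Definition bounded_projector (R : realType) (H : normedModType R)
    (E : set H) (P : H -> H) : Prop :=
  [/\ forall x, E (P x),
      forall x, E x -> P x = x &
      forall B : set H, bounded_set B -> bounded_set (P @` B)].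

(* A map from [0, oo[ * H to the nonempty subsets of H is represented by
   G : R -> H -> set H; its values at negative times are arbitrary, and nothing
   below depends on them. *)
Definition flow_image (R : realType) (H : normedModType R)
    (G : R -> H -> set H) (t : R) (B : set H) : set H :=
  \bigcup_(x in B) G t x.

Definition m_semiflow (R : realType) (H : normedModType R)
    (G : R -> H -> set H) : Prop :=
  [/\ forall t z, 0 <= t -> G t z !=set0,
      forall z, G 0 z = [set z] &
      forall t s z, 0 <= t -> 0 <= s ->
        G (t + s) z `<=` flow_image G t (G s z)].

Definition flow_tail (R : realType) (H : normedModType R)
    (G : R -> H -> set H) (t0 : R) (B : set H) : set H :=
  \bigcup_(t in [set t | t0 <= t]) flow_image G t B.

Definition has_bounded_absorbing_set (R : realType) (H : normedModType R)
    (G : R -> H -> set H) : Prop :=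
  exists2 B0 : set H, bounded_set B0 &
    forall B : set H, bounded_set B ->
      exists2 t0 : R, 0 < t0 & flow_tail G t0 B `<=` B0.

Definition flattening (R : realType) (H : normedModType R)
    (G : R -> H -> set H) : Prop :=
  forall (B : set H) (eps : R), bounded_set B -> 0 < eps ->
  exists (t0 : R) (E : set H) (P : H -> H),
    [/\ 0 <= t0, fin_dim_subspace E, bounded_projector E P,
        bounded_set (P @` flow_tail G t0 B) &
        [set x - P x | x in flow_tail G t0 B] `<=` closed_ball (0 : H) eps].

Definition conditionNW (R : realType) (H : normedModType R)
    (G : R -> H -> set H) : Prop :=
  forall (t : R) (x_ xi_ : nat -> H) (x : H), 0 <= t ->
    x_ n @[n --> \oo] --> x -> (forall n, G t (x_ n) (xi_ n)) ->
  exists (k : nat -> nat) (xi : H),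
    [/\ increasing_seq k, weak_cvg (xi_ \o k) xi & G t x xi].

(* Supremum and infimum are those of [0, +oo]: the infimum over the empty set
   is +oo, and the maximum with 0 makes the supremum over the empty set 0
   (ereal_sup set0 is -oo). *)
Definition semidist (R : realType) (H : normedModType R)
    (A B : set H) : \bar R :=
  maxe 0%E (ereal_sup [set ereal_inf [set `|x - y|%:E | y in B] | x in A]).

Definition global_attractor (R : realType) (H : normedModType R)
    (G : R -> H -> set H) (A : set H) : Prop :=
  [/\ compact A,
      forall t : R, 0 <= t -> A `<=` flow_image G t A &
      forall B : set H, bounded_set B ->
        semidist (flow_image G t B) A @[t --> +oo] --> 0%E].

(* Main.v *)
Require Import Defs.
From HB Require Import structures.
From mathcomp Require Import all_boot all_order all_algebra.
From mathcomp Require Import lra.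
From mathcomp Require Import all_classical all_reals.
From mathcomp Require Import ereal topology normedtype sequences.

Set Implicit Arguments.
Unset Strict Implicit.
Unset Printing Implicit Defensive.

Import Order.TTheory GRing.Theory Num.Theory.
Import numFieldNormedType.Exports.

Local Open Scope classical_set_scope.
Local Open Scope ring_scope.

(** The attractor is the omega-limit set [A] of a bounded absorbing set [B0],
    that is, the intersection over [t] of the closures of the tails
    [flow_tail G t B0].

    Flattening places every late tail of a bounded set within any given
    distance of a compact set: a bounded piece of a finite dimensional subspace
    ([flattening_near_compact]).  Since the space is complete, an ultrafilter
    containing the closures of all tails converges
    ([ultrafilter_near_compact_cvg], [ultrafilter_tail_cvg]).  This gives the
    compactness of [A], and it makes every sequence of points reached at times
    tending to infinity accumulate in the omega-limit set
    ([tail_seq_cluster]).  Attraction follows by contradiction: points reached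
    from a bounded set [B] and staying away from its omega-limit set would
    accumulate at one of its points; that omega-limit set lies in [A] because
    [B0] absorbs [B] ([omega_limit_dist], [omega_limit_absorbing]).

    For the inclusion of [A] in [flow_image G t A], let [y] in [A] be the norm
    limit of points [x_n] reached at times [s_n] tending to infinity, and write
    [x_n] as an element of [G t e_n] with [e_n] reached at time [s_n - t].
    Along a subsequence [e_n] tends to some [e] in [A], and condition NW yields a
    further subsequence of [x_n] with a weak limit in [G t e].  As [x_n]
    tends to [y] in norm, that weak limit is [y] because continuous
    linear functionals separate points ([weak_cvg_norm_cvg]).

    The separation property is a consequence of the Hahn-Banach theorem
    ([hahn_banach]).  Zorn's lemma is applied to sublinear functionals defined
    on the whole space, ordered pointwise: a minimal one is linear. *)

(** * Continuous linear functionals separate points *)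

(** Homogeneity includes the factor [0], so that [p 0 = 0]. *)
Definition sublinear (R : realType) (H : lmodType R) (p : H -> R) : Prop :=
  (forall x y, p (x + y) <= p x + p y) /\
  (forall c x, 0 <= c -> p (c *: x) = c * p x).

Section HahnBanach.
Variables (R : realType) (H : lmodType R).
Implicit Types (p q : H -> R) (F : set (H -> R)).

Lemma sublinear0 p : sublinear p -> p 0 = 0.
Proof. by move=> [_ /(_ 0 0 (lexx _))]; rewrite scale0r mul0r. Qed.

Lemma sublinear_geN p x : sublinear p -> - p (- x) <= p x.
Proof.
move=> sp; have := sp.1 x (- x).
by rewrite subrr (sublinear0 sp); lra.
Qed.

(** The pointwise infimum of [F]; it is meaningful where the values of the
    members of [F] are bounded below. *)
Definition inf_fun F (x : H) : R := inf [set f x | f in F].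

Lemma inf_fun_le F f x :
  has_lbound [set f x | f in F] -> F f -> inf_fun F x <= f x.
Proof. by move=> lbF Ff; apply: ge_inf => //; exists f. Qed.

Lemma le_inf_fun F a x :
  F !=set0 -> (forall f, F f -> a <= f x) -> a <= inf_fun F x.
Proof.
move=> [f0 Ff0] aF; apply: lb_le_inf; first by exists (f0 x), f0.
by move=> _ [f Ff <-]; exact: aF.
Qed.

(** The members of [F] need not be sublinear: it is enough that the defining
    inequalities hold up to a change of member. *)
Lemma inf_fun_sublinear F :
  F !=set0 -> (forall x, has_lbound [set f x | f in F]) ->
  (forall f g x y, F f -> F g -> exists2 h, F h & h (x + y) <= f x + g y) ->
  (forall f c x, F f -> 0 < c -> exists2 h, F h & h (c *: x) <= c * f x) ->
  (forall f, F f -> f 0 = 0) ->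
  sublinear (inf_fun F).
Proof.
move=> F0 lbF addF scaleF zeroF.
have scale_le c x : 0 < c -> inf_fun F (c *: x) <= c * inf_fun F x.
  move=> c0; rewrite -ler_pdivrMl//; apply: le_inf_fun => // f Ff.
  rewrite ler_pdivrMl//; have [h Fh] := scaleF f c x Ff c0.
  by apply: le_trans; exact: inf_fun_le.
split=> [x y|c x].
  rewrite -lerBlDr; apply: le_inf_fun => // f Ff.
  rewrite lerBlDr -lerBlDl; apply: le_inf_fun => // g Fg.
  rewrite lerBlDl; have [h Fh] := addF f g x y Ff Fg.
  by apply: le_trans; exact: inf_fun_le.
rewrite le_eqVlt => /predU1P[<-|c0].
  rewrite scale0r mul0r; apply/eqP; rewrite eq_le; apply/andP; split.
    by have [f Ff] := F0; rewrite -[leRHS](zeroF f Ff); exact: inf_fun_le.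
  by apply: le_inf_fun => // f Ff; rewrite zeroF.
apply/eqP; rewrite eq_le scale_le//= -ler_pdivlMl//.
by rewrite -[in leLHS](scalerK (lt0r_neq0 c0) x) scale_le ?invr_gt0.
Qed.

(** The largest sublinear functional [r] below [q] such that
    [r (x + t *: y) = r x + t * q y] for all [x] and all [t >= 0]; in
    particular [r (- y) = - q y]. *)
Definition straighten q (y : H) : H -> R :=
  inf_fun [set (fun x => q (x + t *: y) - t * q y) | t in [set t | 0 <= t]].

Lemma has_lbound_straighten q y x : sublinear q ->
  has_lbound [set f x | f in
    [set (fun x => q (x + t *: y) - t * q y) | t in [set t | 0 <= t]]].
Proof.
move=> sq; exists (- q (- x)) => _ [_ [t t0 <-] <-].
have := sq.1 (x + t *: y) (- x).
by rewrite addrAC subrr add0r (sq.2 t y t0); lra.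
Qed.

Lemma straighten_le_tail q y t x : sublinear q -> 0 <= t ->
  straighten q y x <= q (x + t *: y) - t * q y.
Proof.
move=> sq t0; pose f x := q (x + t *: y) - t * q y.
apply: (@inf_fun_le _ f); last by exists t.
exact: has_lbound_straighten.
Qed.

Lemma straighten_sublinear q y : sublinear q -> sublinear (straighten q y).
Proof.
move=> sq; apply: inf_fun_sublinear.
- by exists (fun x => q (x + 0 *: y) - 0 * q y), 0 => /=.
- move=> x; exact: has_lbound_straighten.
- move=> _ _ x x' [s s0 <-] [t t0 <-].
  exists (fun x => q (x + (s + t) *: y) - (s + t) * q y).
    by exists (s + t) => //=; exact: addr_ge0.
  have := sq.1 (x + s *: y) (x' + t *: y).
  by rewrite addrACA -scalerDl; lra.
- move=> _ c x [t t0 <-] c0.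
  exists (fun x => q (x + (c * t) *: y) - (c * t) * q y).
    by exists (c * t) => //=; rewrite mulr_ge0// ltW.
  by rewrite -scalerA -scalerDr sq.2 ?(ltW c0)// mulrBr mulrA.
- by move=> _ [t t0 <-]; rewrite add0r sq.2// subrr.
Qed.

Lemma straighten_le q y x : sublinear q -> straighten q y x <= q x.
Proof.
move=> sq; have := straighten_le_tail y x sq (lexx 0).
by rewrite scale0r addr0 mul0r subr0.
Qed.

Lemma exists_minimal_sublinear p : sublinear p ->
  exists q, [/\ sublinear q, forall x, q x <= p x &
    forall q', sublinear q' -> (forall x, q' x <= q x) ->
      forall x, q x <= q' x].
Proof.
move=> sp; pose T := {q | sublinear q /\ forall x, q x <= p x}.
pose below (s t : T) := `[< forall x, projT1 t x <= projT1 s x >].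
have t0 : T by exists p.
have [||A totA|[q [sq qp]] qmin] := @ZL_preorder T t0 below.
- by move=> t; apply/asboolP.
- move=> r s t /asboolP rs /asboolP st; apply/asboolP => x.
  exact: le_trans (st x) (rs x).
- have [[a0 Aa0]|A0] := pselect (A !=set0); last first.
    by exists t0 => s As; exfalso; apply: A0; exists s.
  pose F := [set projT1 a | a in A].
  have F0 : F !=set0 by exists (projT1 a0), a0.
  have lbF x : has_lbound [set f x | f in F].
    exists (- p (- x)) => _ [_ [[q [sq qp]] _ <-] <-] /=.
    by apply: le_trans (sublinear_geN x sq); rewrite lerN2.
  have sF : sublinear (inf_fun F).
    apply: inf_fun_sublinear => //.
    + move=> _ _ x y [a Aa <-] [b Ab <-].
      have [sa _] := projT2 a; have [sb _] := projT2 b.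
      case: (totA a b Aa Ab) => /asboolP ab.
        exists (projT1 b); first by exists b.
        by apply: le_trans (sb.1 _ _) _; rewrite lerD2r.
      exists (projT1 a); first by exists a.
      by apply: le_trans (sa.1 _ _) _; rewrite lerD2l.
    + move=> _ c x [a Aa <-] c0; exists (projT1 a); first by exists a.
      by have [sa _] := projT2 a; rewrite sa.2// ltW.
    + by move=> _ [a _ <-]; apply: sublinear0; exact: (projT2 a).1.
  have Fp x : inf_fun F x <= p x.
    apply: le_trans (inf_fun_le (lbF x) _) _; first by exists a0.
    exact: (projT2 a0).2.
  exists (exist _ (inf_fun F) (conj sF Fp)) => s As; apply/asboolP => x /=.
  by apply: inf_fun_le => //; exists s.
- exists q; split=> // q' sq' q'q x.
  have q'p z : q' z <= p z by exact: le_trans (q'q z) (qp z).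
  have /asboolP := qmin (exist _ q' (conj sq' q'p)) (asboolT q'q).
  exact.
Qed.

(** A minimal sublinear functional is linear, because straightening it in
    any direction cannot make it smaller. *)
Lemma hahn_banach p : sublinear p ->
  exists f : {linear H -> R^o}, forall x, f x <= p x.
Proof.
move=> /exists_minimal_sublinear[q [sq qp qmin]].
have qD x y : q (x + y) = q x + q y.
  apply/eqP; rewrite eq_le sq.1/= -lerBrDr.
  apply: (le_trans (qmin _ (straighten_sublinear y sq) _ x)) => [z|].
    exact: straighten_le.
  by have := straighten_le_tail y x sq ler01; rewrite scale1r mul1r.
have qN x : q (- x) = - q x.
  by apply/eqP; rewrite eq_sym -subr_eq0 -opprD -qD subrr sublinear0// oppr0.
have qlin : linear (q : H -> R^o).
  move=> c x y; rewrite qD; congr (_ + _).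
  have [c0|c0] := leP 0 c; first exact: sq.2.
  by rewrite -[in LHS](opprK c) scaleNr qN sq.2 ?oppr_ge0 1?ltW// mulNr opprK.
pose f : {linear H -> R^o} :=
  HB.pack (q : H -> R^o) (GRing.isLinear.Build R H R^o *:%R q qlin).
by exists f.
Qed.

End HahnBanach.

Lemma continuous_functional_neq0 (R : realType) (H : normedModType R) (v : H) :
  v != 0 -> exists2 f : {linear H -> R^o}, continuous f & f v != 0.
Proof.
move=> v0; have sN : sublinear (fun x : H => `|x|).
  split=> [x y|c x c0]; first exact: ler_normD.
  by rewrite normrZ ger0_norm.
have [f fp] := hahn_banach (straighten_sublinear v sN).
have fN x : f x <= `|x| by apply: le_trans (fp x) (straighten_le _ _ sN).
have f_norm x : `|f x| <= `|x|.
  by rewrite ler_norml fN andbT lerNl -raddfN -normrN fN.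
exists f.
  move=> x; apply/cvgrPdist_lt => e e0; near=> y.
  rewrite -raddfB; apply: le_lt_trans (f_norm _) _.
  by near: y; exact: cvgr_dist_lt.
(* At [t = 1] the straightened norm is at most [- `|v|] at [- v]. *)
have := le_trans (fp (- v)) (straighten_le_tail v (- v) sN ler01).
rewrite scale1r mul1r addNr normr0 add0r raddfN lerN2 => fv.
by rewrite gt_eqF// (lt_le_trans _ fv)// normr_gt0.
Unshelve. all: by end_near. Qed.

Lemma functional_separation (R : realType) (H : normedModType R) (x y : H) :
  (forall f : {linear H -> R^o}, continuous f -> f x = f y) -> x = y.
Proof.
move=> fxy; apply/eqP; rewrite -subr_eq0; apply/negPn/negP.
move=> /continuous_functional_neq0[f cf].
by rewrite linearB /= (fxy f cf) subrr eqxx.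
Qed.

(** The weak limit of a sequence that converges in norm is its norm limit. *)
Lemma weak_cvg_norm_cvg (R : realType) (H : normedModType R) (u : nat -> H)
    (x y : H) : weak_cvg u x -> u @ \oo --> y -> x = y.
Proof.
move=> ux uy; apply: functional_separation => f cf.
apply: (@cvg_unique _ (@norm_hausdorff R R^o) (f (u n) @[n --> \oo])).
  exact: ux.
exact: continuous_cvg (cf y) uy.
Qed.

(** * Bounded sets in finite dimensional subspaces *)

(** For a subspace [E] this amounts to [E] being finite dimensional; no basis
    appears, so that vectors can be added one at a time. *)
Definition compact_balls (R : realType) (H : normedModType R) (E : set H) :=
  forall r : R, compact (E `&` [set x | `|x| <= r]).

Section FiniteDimension.
Variables (R : realType) (H : normedModType R).
Implicit Types (E : set H) (e : H).

Lemma closed_norm_le (r : R) : closed [set x : H | `|x| <= r].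
Proof.
have := @closed_closed_ball_ R H 0 r; congr closed.
by apply/seteqP; split=> x /=; rewrite /closed_ball_ /= sub0r normrN.
Qed.

Lemma compact_balls_closed E : compact_balls E -> closed E.
Proof.
move=> cE x clx; have cK := cE (`|x| + 1).
suff : (E `&` [set y | `|y| <= `|x| + 1]) x by case.
apply: (compact_closed (@norm_hausdorff _ _) cK) => U Ux.
have Bx : nbhs x (ball x 1) by exact: nbhsx_ballx.
have [y [Ey [Uy]]] := clx _ (filterI Ux Bx).
rewrite -ball_normE /= distrC => xy; exists y; split=> //; split=> //=.
by have := ler_normD x (y - x); rewrite addrC subrK; lra.
Qed.

(** If [e] is outside [E], it lies at a positive distance from the closed
    subspace [E], which bounds the coefficient [c] in terms of the norm of
    [x + c *: e]. *)
Lemma compact_balls_add_line E e :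
  E 0 -> (forall a x y, E x -> E y -> E (a *: x + y)) -> compact_balls E ->
  compact_balls [set x + c *: e | x in E & c in [set: R]].
Proof.
move=> E0 Elin cE; have [Ee r|Ee] := pselect (E e).
  rewrite (_ : [set _ | _ in _ & _ in _] = E) //.
  apply/seteqP; split=> [_ [x Ex [c _ <-]]|x Ex]; last first.
    by exists x => //; exists 0 => //; rewrite scale0r addr0.
  by rewrite addrC; exact: Elin.
have EZ c x : E x -> E (c *: x).
  by move=> Ex; rewrite -[_ *: _]addr0; exact: Elin.
have [d d0 dE] : exists2 d : R, 0 < d & forall x, E x -> d <= `|e - x|.
  have : nbhs e (~` E).
    apply: open_nbhs_nbhs; split=> //.
    by apply: closed_openC; exact: compact_balls_closed.
  move=> /nbhs_ballP[d /= d0 dE]; exists d => // x Ex; rewrite leNgt.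
  by apply/negP => xd; apply: (dE x) => //; rewrite -ball_normE.
have coef_le x c : E x -> `|c| * d <= `|x + c *: e|.
  move=> Ex; have [->|c0] := eqVneq c 0; first by rewrite normr0 mul0r.
  have -> : x + c *: e = c *: (e - (- c^-1) *: x).
    by rewrite scaleNr opprK scalerDr scalerA divff// scale1r addrC.
  by rewrite normrZ ler_wpM2l// dE//; exact: EZ.
move=> r; pose M := r / d.
pose h (z : H * R^o) := z.1 + z.2 *: e.
pose K := h @` ((E `&` [set x | `|x| <= r + M * `|e|]) `*` `[- M, M]%classic).
have cK : compact K.
  apply: continuous_compact.
    apply: continuous_subspaceT => z; apply: cvgD; first exact: cvg_fst.
    by apply: cvgZr_tmp; exact: cvg_snd.
  by apply: compact_setX => //; exact: segment_compact.
rewrite (_ : _ `&` _ = K `&` [set x | `|x| <= r]); last first.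
  apply/seteqP; split.
    move=> _ [[x Ex [c _ <-]] /= xr]; split=> //; exists (x, c) => //=.
    have cM : `|c| <= M by rewrite ler_pdivlMr// (le_trans (coef_le x c Ex)).
    split; last by rewrite in_itv /= -ler_norml.
    split=> //=; have := ler_normB (x + c *: e) (c *: e).
    rewrite addrK normrZ; have : `|c| * `|e| <= M * `|e| by exact: ler_wpM2r.
    lra.
  move=> _ [[[x c] /= [[Ex _] _] <-] xr]; split=> //.
  by exists x => //; exists c.
exact: compact_closedI cK (@closed_norm_le r).
Qed.

(** The linear span of a finite family, which need not be free. *)
Definition lin_span n (e : 'I_n -> H) : set H :=
  [set \sum_(i < n) c i *: e i | c in [set: 'I_n -> R]].

Lemma lin_span0 n (e : 'I_n -> H) : lin_span e 0.
Proof.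
by exists (fun=> 0) => //; rewrite big1// => i _; rewrite scale0r.
Qed.

Lemma lin_span_linear n (e : 'I_n -> H) a x y :
  lin_span e x -> lin_span e y -> lin_span e (a *: x + y).
Proof.
move=> [b _ <-] [c _ <-]; exists (fun i => a * b i + c i) => //.
rewrite scaler_sumr -big_split; apply: eq_bigr => i _ /=.
by rewrite scalerDl scalerA.
Qed.

Lemma lin_spanS n (e : 'I_n.+1 -> H) :
  lin_span e =
  [set x + c *: e ord_max | x in lin_span (e \o widen_ord (leqnSn n))
                          & c in [set: R]].
Proof.
apply/seteqP; split=> [_ [c _ <-]|_ [_ [c _ <-] [a _ <-]]].
  rewrite big_ord_recr /=; exists (\sum_(i < n)
    c (widen_ord (leqnSn n) i) *: e (widen_ord (leqnSn n) i)).
    by exists (c \o widen_ord (leqnSn n)).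
  by exists (c ord_max).
(* The last index is the only one outside ['I_n], hence gets the default [a]. *)
exists (fun i => oapp c a (insub (i : nat))) => //.
rewrite big_ord_recr /= insubF ?ltnn//=; congr (_ + _).
apply: eq_bigr => i _; congr (_ *: _).
by rewrite insubT /= ?ltn_ord// => li; congr c; exact: val_inj.
Qed.

Lemma lin_span_compact_balls n (e : 'I_n -> H) : compact_balls (lin_span e).
Proof.
elim: n e => [e r|n IHn e].
  rewrite (_ : lin_span e = [set 0]).
    exact: compact_closedI (@compact_set1 _ 0) (@closed_norm_le r).
  apply/seteqP; split=> [_ [c _ <-]|_ ->]; last exact: lin_span0.
  by rewrite big_ord0.
rewrite lin_spanS; apply: compact_balls_add_line => //.
  exact: lin_span0.
by move=> a x y; exact: lin_span_linear.
Qed.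

Lemma fin_dim_subspace_compact_balls E :
  fin_dim_subspace E -> compact_balls E.
Proof. by move=> [n [e ->]]; exact: lin_span_compact_balls. Qed.

Lemma bounded_set_norm_le (A : set H) :
  bounded_set A -> exists M : R, forall x, A x -> `|x| <= M.
Proof. by move=> /ex_strict_bound_gt0[M _ AM]; exists M => x /AM /ltW. Qed.

End FiniteDimension.

(** * Omega-limit sets of flattening semiflows *)

Section Convergence.
Variables (R : realType).

(** The filter form of the fact that a set which is arbitrarily close to
    compact sets is relatively compact. *)
Lemma ultrafilter_near_compact_cvg (H : completeNormedModType R)
    (U : set_system H) : UltraFilter U ->
  (forall eps : R, 0 < eps -> exists2 K : set H, compact K &
    U [set x | exists2 k, K k & `|x - k| < eps]) ->
  cvg U.
Proof.
move=> UU nearK; apply: cauchy_cvg; apply: cauchy_exP => eps eps0.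
have e20 : 0 < eps / 2 by rewrite divr_gt0.
have [K cK UK] := nearK _ e20.
have /choice[g gP] : forall x, exists y,
    (exists2 k, K k & `|x - k| < eps / 2) -> K y /\ `|x - y| < eps / 2.
  move=> x.
  have [[k Kk xk]|nk] := pselect (exists2 k, K k & `|x - k| < eps / 2).
    by exists k.
  by exists 0 => /nk.
have gUK : U (g @^-1` K) by apply: filterS UK => x Sx; exact: (gP x Sx).1.
have [p [_ clp]] := cK (g @ U) _ gUK; exists p.
have [//|nUp] := in_ultra_setVsetC (ball p eps) UU; exfalso.
(* Otherwise some [x] outside the ball is close to [g x], itself close to
   [p]. *)
pose S := [set x | exists2 k, K k & `|x - k| < eps / 2] `&` ~` ball p eps.
have US : U (g @^-1` (g @` S)).
  by apply: filterS (filterI UK nUp) => x Sx; exists x.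
have [_ [[x [/gP[_ xg] xp] <-] pg]] := clp _ _ US (nbhsx_ballx p _ e20).
apply: xp; move: pg; rewrite -!ball_normE /= => pg.
by have := ler_distD (g x) p x; move: xg; rewrite (distrC x); lra.
Qed.

(** The extraction [k] need not be increasing; [n <= k n] suffices below. *)
Lemma cluster_subseq (H : normedModType R) (u : nat -> H) (y : H) :
  cluster (u @ \oo) y ->
  exists2 k : nat -> nat, (forall n, (n <= k n)%N) & (u \o k) @ \oo --> y.
Proof.
move=> cly.
have /choice[k kP] : forall n, exists m,
    (n <= m)%N /\ ball y n.+1%:R^-1 (u m).
  move=> n.
  have un : (u @ \oo) (u @` [set m | (n <= m)%N]).
    by exists n => // m /= nm; exists m.
  have yn : nbhs y (ball y (n.+1%:R^-1 : R)).
    by apply: nbhsx_ballx; rewrite invr_gt0.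
  by have [_ [[m nm <-] um]] := cly _ _ un yn; exists m.
exists k => [n|]; first by have [] := kP n.
apply/cvgrPdist_lt => e e0.
move/cvgrPdist_lt : (@cvg_harmonic R) => /(_ e e0).
apply: filterS => n /=.
rewrite sub0r normrN ger0_norm// => ne; have [_] := kP n.
by rewrite -ball_normE /= => /lt_trans; apply.
Qed.

End Convergence.

Lemma ler_bound (R : realType) (t : R) : t <= (Num.bound `|t|)%:R.
Proof.
by apply: le_trans (ler_norm t) _; apply: ltW; exact: archi_boundP.
Qed.

Section OmegaLimit.
Variables (R : realType) (H : completeNormedModType R) (G : R -> H -> set H).
Implicit Types (B : set H) (U : set_system H).

Lemma flow_tail_subset (s t : R) B :
  s <= t -> flow_tail G t B `<=` flow_tail G s B.
Proof. by move=> st x [r /= tr Gx]; exists r => //=; exact: le_trans tr. Qed.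

(** The omega-limit set of [B].  It is enough to intersect over integer times,
    because the tails decrease. *)
Definition omega_limit B : set H :=
  \bigcap_(n in [set: nat]) closure (flow_tail G n%:R B).

Lemma omega_limitP B x :
  omega_limit B x <-> forall t, closure (flow_tail G t B) x.
Proof.
split=> [xB t|xB n _]; last exact: xB.
apply: (closure_subset _ (xB (Num.bound `|t|) I)).
by apply: flow_tail_subset; exact: ler_bound.
Qed.

Section Flattening.
Hypothesis G_flattening : flattening G.

Lemma flattening_near_compact B (eps : R) : bounded_set B -> 0 < eps ->
  exists (t0 : R) (K : set H), compact K /\
    forall x, flow_tail G t0 B x -> exists2 k, K k & `|x - k| <= eps.
Proof.
move=> bB eps0.
have [t0 [E [P [_ Efin [PE _ _] bPB PB]]]] := G_flattening bB eps0.
have [M PM] := bounded_set_norm_le bPB.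
exists t0, (E `&` [set x | `|x| <= M]).
split=> [|x Bx]; first exact: fin_dim_subspace_compact_balls.
exists (P x); first by split; [exact: PE|apply: PM; exists x].
have : closed_ball (0 : H) eps (x - P x) by apply: PB; exists x.
by rewrite closed_ballE// /closed_ball_ /= sub0r normrN.
Qed.

Lemma ultrafilter_tail_cvg B U : bounded_set B -> UltraFilter U ->
  (forall t, U (closure (flow_tail G t B))) ->
  exists2 y, omega_limit B y & U --> y.
Proof.
move=> bB UU UB; have /cvg_ex[y Uy] : cvg U.
  apply: ultrafilter_near_compact_cvg => eps eps0.
  have e20 : 0 < eps / 2 by rewrite divr_gt0.
  have [t0 [K [cK BK]]] := flattening_near_compact bB e20.
  exists K => //; apply: filterS (UB t0) => x clx.
  have [z [Bz]] := clx _ (nbhsx_ballx x _ e20); rewrite -ball_normE /= => xz.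
  have [k Kk zk] := BK z Bz; exists k => //.
  by have := ler_distD z x k; lra.
exists y => // n _; apply: closed_closure => A yA.
by have [x []] := filter_ex (filterI (UB n%:R) (Uy _ yA)); exists x.
Qed.

Lemma omega_limit_compact B : bounded_set B -> compact (omega_limit B).
Proof.
move=> bB; rewrite compact_ultra => U UU UA.
have [|y Ay Uy] := ultrafilter_tail_cvg bB UU; last by exists y.
by move=> t; apply: filterS UA => x /omega_limitP.
Qed.

(** Asymptotic compactness: points reached at times tending to infinity
    accumulate at some point of the omega-limit set. *)
Lemma tail_seq_cluster B (u : nat -> H) : bounded_set B ->
  (forall n, flow_tail G n%:R B (u n)) ->
  exists2 y, omega_limit B y & cluster (u @ \oo) y.
Proof.
move=> bB uB.
have [U [UU uU]] := @ultraFilterLemma _ (u @ \oo) _.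
have [|y Ay Uy] := ultrafilter_tail_cvg bB UU.
  move=> t; apply: uU; exists (Num.bound `|t|) => // n /= tn.
  apply: subset_closure; apply: (flow_tail_subset _ (uB n)).
  by apply: le_trans (ler_bound t) _; rewrite ler_nat.
by exists y => //; rewrite cluster_cvgE; exists U => //; exact: ultra_proper.
Qed.

Hypothesis G_semiflow : m_semiflow G.

(** After the time at which [B] is absorbed, the trajectories of [B] are
    trajectories of [B0]. *)
Lemma omega_limit_absorbing B0 B (t0 : R) : 0 <= t0 ->
  flow_tail G t0 B `<=` B0 -> omega_limit B `<=` omega_limit B0.
Proof.
move=> t00 BB0 x /omega_limitP xB; apply/omega_limitP => t.
apply: closure_subset (xB (Num.max t 0 + t0)) => z [s /= ts [b Bb Gz]].
have [_ _ Gadd] := G_semiflow.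
have tmax : t <= Num.max t 0 by rewrite le_max lexx.
have t0max : 0 <= Num.max t 0 by rewrite le_max lexx orbT.
have [||w Gw Gwz] := Gadd (s - t0) t0 b _ t00 z; [by lra|by rewrite subrK|].
exists (s - t0) => /=; first by lra.
by exists w => //; apply: BB0; exists t0 => //=; exists b.
Qed.

(** The omega-limit set of a bounded set attracts that set uniformly. *)
Lemma omega_limit_dist B (eps : R) : bounded_set B -> 0 < eps ->
  exists T, forall x, flow_tail G T B x ->
    exists2 a, omega_limit B a & `|x - a| < eps.
Proof.
move=> bB eps0; apply: contrapT => far.
have /choice[u uP] : forall n : nat, exists x, flow_tail G n%:R B x /\
    forall a, omega_limit B a -> eps <= `|x - a|.
  move=> n; apply: contrapT => nofar; apply: far; exists n%:R => x Bx.
  apply: contrapT => xfar; apply: nofar; exists x; split=> // a Ba.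
  by rewrite leNgt; apply/negP => xa; apply: xfar; exists a.
have [n|y By cly] := tail_seq_cluster bB (u := u); first by have [] := uP n.
have [k _ /cvgrPdist_lt/(_ _ eps0)/filter_ex[n /=]] := cluster_subseq cly.
by have [_ /(_ y By)] := uP (k n); rewrite distrC; lra.
Qed.

Hypothesis G_NW : conditionNW G.

Lemma omega_limit_negatively_invariant B (t : R) : bounded_set B -> 0 <= t ->
  omega_limit B `<=` flow_image G t (omega_limit B).
Proof.
move=> bB t0 y /omega_limitP By; have [_ _ Gadd] := G_semiflow.
(* [xe n] is a pair of a point within [1 / (n + 1)] of [y] and a point, reached
   from [B] at time at least [n], whose image at time [t] contains it. *)
have /choice[xe xeP] : forall n : nat, exists xe : H * H,
    [/\ ball y n.+1%:R^-1 xe.1, G t xe.2 xe.1 & flow_tail G n%:R B xe.2].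
  move=> n; have yn : nbhs y (ball y (n.+1%:R^-1 : R)).
    by apply: nbhsx_ballx; rewrite invr_gt0.
  have [x [[s /= ns [b Bb Gx]] yx]] := By (n%:R + t) _ yn.
  have n0 : 0 <= n%:R :> R by [].
  have [||e Ge Gex] := Gadd t (s - t) b t0 _ x; [by lra|by rewrite subrKC|].
  exists (x, e); split=> //; exists (s - t) => /=; first by lra.
  by exists b.
have [n|e Be cle] := tail_seq_cluster bB (u := snd \o xe).
  by have [] := xeP n.
have [k kn ke] := cluster_subseq cle.
have [n|j [x [jinc jx Gx]]] := G_NW t0 ke (xi_ := fst \o xe \o k).
  by have [] := xeP (k n).
suff <- : x = y by exists e.
(* The weakly convergent subsequence still tends to [y] in norm. *)
apply: weak_cvg_norm_cvg jx _; apply/cvgrPdist_lt => eps eps0.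
move/cvgrPdist_lt : (@cvg_harmonic R) => /(_ eps eps0).
apply: filterS => n /=; rewrite sub0r normrN ger0_norm// => neps.
have [+ _ _] := xeP (k (j n)); rewrite -ball_normE /= => /lt_le_trans; apply.
apply: le_trans (ltW neps); rewrite lef_pV2 ?posrE// ler_nat ltnS.
apply: leq_trans (kn _); elim: n {neps} => // n IHn.
by apply: leq_ltn_trans IHn _; rewrite ltnNge -leEnat jinc ltnn.
Qed.

End Flattening.

End OmegaLimit.

(** * Existence of the global attractor *)

Lemma semidist_le (R : realType) (H : normedModType R) (A B : set H)
    (eps : R) : 0 <= eps ->
  (forall x, A x -> exists2 y, B y & `|x - y| <= eps) ->
  (0 <= semidist A B <= eps%:E)%E.
Proof.
move=> eps0 AB; rewrite /semidist le_max lexx/= ge_max lee_fin eps0/=.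
apply: ge_ereal_sup => _ [x Ax <-]; have [y By xy] := AB x Ax.
apply: (@le_trans _ _ `|x - y|%:E%E); last by rewrite lee_fin.
by apply: ereal_inf_lbound; exists y.
Qed.

Lemma cvge0_squeeze (R : realType) T (F : set_system T) {FF : Filter F}
    (f : T -> \bar R) :
  (forall eps : R, 0 < eps -> \forall x \near F, (0 <= f x <= eps%:E)%E) ->
  f @ F --> 0%E.
Proof.
move=> f0; apply/fine_cvgP; split.
  apply: filterS (f0 1 ltr01) => x /andP[fx0 fx1].
  by rewrite ge0_fin_numE// (le_lt_trans fx1) ?ltry.
apply/cvgrPdist_le => eps eps0; apply: filterS (f0 _ eps0) => x /andP[fx0 fxe].
rewrite sub0r normrN ger0_norm ?fine_ge0//.
rewrite -lee_fin fineK// ge0_fin_numE//.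
by rewrite (le_lt_trans fxe) ?ltry.
Qed.

Theorem corollary2p2 (R : realType) (H : completeNormedModType R)
    (G : R -> H -> set H)
    (H_uc : uniformly_convex H)
    (G_semiflow : m_semiflow G)
    (G_absorbing : has_bounded_absorbing_set G)
    (G_flattening : flattening G)
    (G_NW : conditionNW G) :
  exists A : set H, global_attractor G A.
Proof.
have [B0 bB0 B0abs] := G_absorbing; exists (omega_limit G B0); split.
- exact: omega_limit_compact.
- by move=> t t0; exact: omega_limit_negatively_invariant.
move=> B bB; have [t0 t00 BB0] := B0abs B bB.
apply: cvge0_squeeze => eps eps0.
have [T BT] := omega_limit_dist G_flattening bB eps0.
near=> t; apply: semidist_le; first exact: ltW.
move=> x Bx; have [|a Ba xa] := BT x.
  by exists t => //=; near: t; apply: nbhs_pinfty_ge; exact: num_real.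
exists a; last exact: ltW.
exact: omega_limit_absorbing (ltW t00) BB0 _ Ba.
Unshelve. all: by end_near. Qed.
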